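(* Let $f_0 \in \mathbf{F}_2[x]$ be any irreducible polynomial of degree $n = 2^l \cdot m$, where $m$ is odd and $l \geq 0$ is an integer. Then there exist an integer $s$ with $0 \leq s \leq l+3$ and an infinite sequence $\{f_i\}_{i \geq 0}$ of irreducible polynomials of $\mathbf{F}_2[x]$ starting with the given $f_0$ such that: (i) for every $i \geq 0$, $f_{i+1}$ is an irreducible factor of the $Q$-transform $f_i^Q$; (ii) $f_s$ is of type $(A,n)$ or of type $(A,2n)$; (iii) for every $i \geq s$, $f_{i+1} = f_i^Q$, so that $\deg f_{i+1} = 2 \deg f_i$. More precisely, $s$ and the sequence can be chosen so that: if $f_0$ is of type $(A,n)$, then $s=0$; if $f_0$ is of type $(B,n)$ with $n>1$, then $s \leq l+2$ and $f_s$ is of type $(A,2n)$; if $f_0$ is of type $(B,1)$, then $s=1$ and $f_1(x)=x+1$; if $f_0$ is of type $(C,n)$, then $s \leq l+3$ and $f_s$ is of type $(A,2n)$; if $f_0$ is of type $(D,n)$, then $s \leq l+2$ and $f_s$ is of type $(A,n)$.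
   Context: $\mathbf{F}_2$ is the field with two elements. For $f \in \mathbf{F}_2[x]$ of degree $n$, its $Q$-transform is the polynomial $f^Q(x) = x^n \cdot f(x+x^{-1})$ of degree $2n$. An irreducible polynomial $f(x) = x^n + a_{n-1}x^{n-1} + \dots + a_1 x + a_0 \in \mathbf{F}_2[x]$ of degree $n$ is of type $(A,n)$ if $a_{n-1}=a_1=1$; of type $(B,n)$ if $a_{n-1}=0$ and $a_1=1$; of type $(C,n)$ if $a_{n-1}=1$ and $a_1=0$; of type $(D,n)$ if $a_{n-1}=a_1=0$. (For $n=1$, $a_1 = 1$ is the leading coefficient, so $x$ is of type $(B,1)$ and $x+1$ is of type $(A,1)$.) *)

(* Defs.v *)
From HB Require Import structures.
From mathcomp Require Import all_boot all_order all_algebra.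

Set Implicit Arguments.
Unset Strict Implicit.
Unset Printing Implicit Defensive.

Import GRing.Theory.
Local Open Scope ring_scope.

(* x^n f(x + x^-1), with n = (size f).-1, after clearing denominators:
   x^n (x + x^-1)^i = x^(n - i) (x^2 + 1)^i; see QtransformE. *)
Definition Qtransform (f : {poly 'F_2}) : {poly 'F_2} :=
  \sum_(i < size f) f`_i *: ('X^((size f).-1 - i) * ('X^2 + 1) ^+ i).

Lemma QtransformE (f : {poly 'F_2}) :
  let x : {fraction {poly 'F_2}} := tofrac 'X in
  tofrac (Qtransform f)
    = x ^+ (size f).-1 * (map_poly (fun c : 'F_2 => tofrac c%:P) f).[x + x^-1].
Proof.
move=> x; have x0 : x != 0 by rewrite /x tofrac_eq0 polyX_eq0.
have mE : map_poly (fun c : 'F_2 => tofrac c%:P) f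
          = \poly_(i < size f) tofrac (f`_i)%:P :> {poly {fraction {poly 'F_2}}}.
  by rewrite map_polyE -[in LHS](coefK f) poly_def;
     apply/polyP=> i; rewrite coef_Poly coef_poly -poly_def coefK;
     case: ltnP => hi; [rewrite (nth_map 0) | rewrite nth_default ?size_map].
rewrite mE horner_poly /Qtransform rmorph_sum mulr_sumr.
apply: eq_bigr => i _ /=.
have hi : (i <= (size f).-1)%N by rewrite -ltnS (ltn_predK (ltn_ord i)).
rewrite -mul_polyC !rmorphM !rmorphXn rmorphD rmorphXn rmorph1 /= -/x.
rewrite [RHS]mulrCA; congr (_ * _).
rewrite -[in RHS](subnK hi) exprD -mulrA -exprMn; congr (_ * _ ^+ i).
by rewrite mulrDr divff // expr2.
Qed.

(* Irreducible of degree n with a_(n-1) = a and a_1 = b; irreducibility forces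
   n >= 1, so n.-1 is genuinely n - 1, and f is monic as its leading
   coefficient is a nonzero element of F_2. *)
Definition has_type (a b : 'F_2) (f : {poly 'F_2}) (n : nat) : Prop :=
  [/\ irreducible_poly f, size f = n.+1, f`_n.-1 = a & f`_1 = b].

Definition typeA := has_type 1 1.
Definition typeB := has_type 0 1.
Definition typeC := has_type 1 0.
Definition typeD := has_type 0 0.

(* Main.v *)
(* On the ordinary curve E : y^2 + x y = x^3 + 1 over F_2, Frobenius pi satisfies
   pi^2 + pi + 2 = 0, and x |-> x + 1/x is the action on x-coordinates of its dual
   V = -1 - pi.  Going from f to an irreducible factor of f^Q replaces a root by a
   V-preimage, and the traces of the root and of its inverse (the coefficients
   a_(n-1) and a_1) decide whether that preimage stays in F_(2^n) and which type
   it has.  Type A, once reached, is preserved with the degree doubling at each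
   step, so everything reduces to bounding the time spent in type D.

   If two chains of V-preimages, starting from b and 1/b (points that differ by
   the kernel of V), remain rational for too long, then the difference of their
   members is a rational point of order V^k.  But the x-coordinates of points of
   order V^(j+2) generate F_(2^(2^j)), so k <= l + 2 over F_(2^(2^l m)), m odd.
   For type D the two chains are independent; for type B they are conjugate over
   F_(2^n) inside F_(2^(2n)), which makes the difference rational over F_(2^n)
   and saves one step.  Only x-coordinates are used, through Semaev's third
   summation polynomial. *)
Require Import Defs.
From HB Require Import structures.
From mathcomp Require Import all_boot all_order all_algebra.
From mathcomp Require Import closed_field.
From mathcomp Require Import ring zify.

Set Implicit Arguments.
Unset Strict Implicit.
Unset Printing Implicit Defensive.

Import GRing.Theory.
Local Open Scope ring_scope.

(** * Powers of Frobenius and absolute traces in characteristic two *)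

Section CharTwo.

Variable K : fieldType.
Hypothesis char2 : 2 \in [pchar K].

Definition frob n (x : K) := x ^+ (2 ^ n).
Definition tr n (x : K) := \sum_(i < n) frob i x.

Lemma two0 : 2%:R = 0 :> K.
Proof. exact: pcharf0 char2. Qed.

Lemma addKK (x : K) : x + x = 0.
Proof. exact: addrr_pchar2 char2 x. Qed.

Lemma opp_pchar2 (x : K) : - x = x.
Proof. exact: oppr_pchar2 char2 x. Qed.

Lemma eq_add0 (x y : K) : (x + y == 0) = (x == y).
Proof. by rewrite addr_eq0 opp_pchar2. Qed.

(** Lets [ring] and [field], which do not know that 2 = 0, prove identities modulo 2: the even terms
    are collected in the cofactor [e]. *)
Lemma eq_mod2 (x y e : K) : x = y + 2%:R * e -> x = y.
Proof. by rewrite two0 mul0r addr0. Qed.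

Lemma frob0 x : frob 0 x = x. Proof. by rewrite /frob expr1. Qed.

Lemma frobS n x : frob n.+1 x = frob n x ^+ 2.
Proof. by rewrite /frob -exprM expnSr. Qed.

Lemma frobA m n x : frob m (frob n x) = frob (m + n) x.
Proof. by rewrite /frob -exprM -expnD addnC. Qed.

Lemma frobD n : {morph frob n : x y / x + y}.
Proof.
move=> x y; rewrite /frob exprDn_pchar //.
by rewrite pnatX pnatE // char2.
Qed.

Lemma frobM n : {morph frob n : x y / x * y}.
Proof. by move=> x y; rewrite /frob exprMn. Qed.

Lemma frobV n x : frob n x^-1 = (frob n x)^-1.
Proof. by rewrite /frob exprVn. Qed.

Lemma frobX n k x : frob n (x ^+ k) = frob n x ^+ k.
Proof. by rewrite /frob exprAC. Qed.

Lemma frob_1 n : frob n 1 = 1. Proof. by rewrite /frob expr1n. Qed.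

Lemma frob_0 n : frob n 0 = 0. Proof. by rewrite /frob expr0n gtn_eqF ?expn_gt0. Qed.

Lemma frob_sum n (I : Type) (r : seq I) (F : I -> K) :
  frob n (\sum_(i <- r) F i) = \sum_(i <- r) frob n (F i).
Proof. exact: (big_morph _ (@frobD n) (frob_0 n)). Qed.

Lemma frob_eq0 n x : (frob n x == 0) = (x == 0).
Proof. by rewrite /frob expf_eq0 expn_gt0. Qed.

Lemma frob_inj n : injective (frob n).
Proof. by move=> x y /eqP; rewrite -eq_add0 -frobD frob_eq0 eq_add0 => /eqP. Qed.

Lemma frob_mul n k x : frob n x = x -> frob (k * n) x = x.
Proof. by move=> h; elim: k => [|k IH]; rewrite ?frob0 // mulSn -frobA IH. Qed.

Lemma trS n x : tr n.+1 x = tr n x + frob n x.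
Proof. exact: big_ord_recr. Qed.

Lemma trD n : {morph tr n : x y / x + y}.
Proof. by move=> x y; rewrite /tr -big_split; apply: eq_bigr => i _; rewrite frobD. Qed.

Lemma frob_tr k n x : frob k (tr n x) = tr n (frob k x).
Proof. by rewrite /tr frob_sum; apply: eq_bigr => i _; rewrite !frobA addnC. Qed.

Lemma tr_add m n x : tr (m + n) x = tr m x + tr n (frob m x).
Proof.
elim: n => [|n IH]; first by rewrite addn0 /tr big_ord0 addr0.
by rewrite addnS !trS IH -addrA frobA (addnC m n).
Qed.

Lemma tr_double n x : tr (2 * n) x = tr n (x + frob n x).
Proof. by rewrite mul2n -addnn tr_add trD. Qed.

Lemma tr_AS n y : tr n (y ^+ 2 + y) = frob n y + y.
Proof.
elim: n => [|n IH]; first by rewrite frob0 addKK /tr big_ord0.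
rewrite trS IH frobD frobX frobS; apply: (@eq_mod2 _ _ (frob n y)); ring.
Qed.

Lemma AS_frob n y c : y ^+ 2 + y = c -> frob n y = y + tr n c.
Proof. by move=> <-; rewrite tr_AS addrC -addrA addKK addr0. Qed.

Lemma tr_frobE n x : frob n x = x -> tr n x = 0 \/ tr n x = 1.
Proof.
move=> h; have /eqP : tr n x ^+ 2 = tr n x.
  have := frob_tr 1 n x; rewrite {1}/frob expn1 => ->.
  have := tr_AS n x; rewrite h addKK trD /frob expn1 => /eqP.
  by rewrite eq_add0 => /eqP.
rewrite -subr_eq0 expr2 -{3}[tr n x]mulr1 -mulrBr mulf_eq0 subr_eq0.
by case/orP => /eqP; [left|right].
Qed.

(** * Preimages under [b + 1/b] *)

(* [b + 1/b = a] without denominators: [b != 0] follows. *)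
Definition step (a b : K) := b ^+ 2 + 1 = a * b.

Lemma step_neq0 a b : step a b -> b != 0.
Proof.
by apply: contra_eq_neq => ->; rewrite expr0n mulr0 add0r oner_eq0.
Qed.

Lemma stepE a b : step a b -> a = b + b^-1.
Proof.
move=> h; have b0 := step_neq0 h; apply: (mulIf b0).
by rewrite -h mulrDl mulVf.
Qed.

Lemma stepI b : b != 0 -> step (b + b^-1) b.
Proof. by move=> b0; rewrite /step mulrDl mulVf. Qed.

Lemma stepV a b : step a b -> step a b^-1.
Proof.
move=> h; have := @stepI b^-1; rewrite invr_eq0 invrK addrC -(stepE h); apply.
exact: step_neq0 h.
Qed.

Lemma step_frob n a b : step a b -> step (frob n a) (frob n b).
Proof. by rewrite /step -frobX -[1](frob_1 n) -frobD -frobM frob_1 => ->. Qed.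

(** [b / a] solves [y^2 + y = a^-2], so [frob n] adds [tr n a^-1] to it; adding 1 to [b / a] turns
    [b] into [b + a = b^-1], the other root. *)
Lemma step_frob_fix n a b : a != 0 -> frob n a = a -> step a b ->
  (tr n a^-1 = 0 -> frob n b = b) /\ (tr n a^-1 = 1 -> frob n b = b^-1).
Proof.
move=> a0 fa h; have b0 := step_neq0 h.
have e : (b / a) ^+ 2 + b / a = (a^-1) ^+ 2.
  apply: (mulIf (expf_neq0 2 a0)); apply: (@eq_mod2 _ _ (a * b - 1)).
  rewrite !mulrDl -!exprMn divfK // mulVf // expr2 mulrA divfK // -expr2.
  by move: h; rewrite /step => h; rewrite mulrC -h; ring: h.
have fb := AS_frob n e.
have t2 : tr n (a^-1 ^+ 2) = tr n a^-1.
  have := frob_tr 1 n a^-1; rewrite /frob expn1 => <-.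
  have fV : frob n a^-1 = a^-1 by rewrite frobV fa.
  by case: (tr_frobE fV) => ->; rewrite ?expr0n ?expr1n.
have {}fb : frob n b = b + a * tr n a^-1.
  move: fb; rewrite frobM frobV fa t2 => fb.
  by rewrite -[LHS](divfK a0) fb mulrDl divfK // mulrC.
split=> t; rewrite fb t ?mulr0 ?addr0 // mulr1 (stepE h).
by rewrite addrA addKK add0r.
Qed.


Lemma tr_sqr n x : tr n (x ^+ 2) = tr n x ^+ 2.
Proof. by have := frob_tr 1 n x; rewrite /frob expn1 => ->. Qed.

Lemma frob_mul_inv n q b :
  frob n b = b^-1 -> frob (q * n) b = if odd q then b^-1 else b.
Proof.
move=> h; elim: q => [|q IH]; first by rewrite frob0.
by rewrite mulSn -frobA IH /=; case: odd; rewrite ?frobV h ?invrK.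
Qed.

Lemma step_neq_inv a b : a != 0 -> step a b -> b != b^-1.
Proof.
move=> a0 h; apply: contra_neq a0 => e.
by rewrite (stepE h) -e addKK.
Qed.

(** * Semaev's third summation polynomial *)

(* [S3 a b c = 0] says that [a, b, c] are the x-coordinates of points [P, Q, R]
   of the curve with [P + Q + R = 0]. *)
Definition S3 a b c : K :=
  (a * b) ^+ 2 + (b * c) ^+ 2 + (c * a) ^+ 2 + a * b * c + 1.

(* In characteristic 2, up to the factor [(a' b' c')^2 / c'^2], [S3] of the images
   splits as [S3 a' b' c' * S3 a' b' c'^-1]. *)
Lemma S3_step a b c a' b' c' : step a a' -> step b b' -> step c c' ->
  S3 a b c = 0 -> exists2 c'', step c c'' & S3 a' b' c'' = 0.
Proof.
move=> ha hb hc h.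
have [a0 b0 c0] : [/\ a' != 0, b' != 0 & c' != 0].
  by split; [apply: step_neq0 ha | apply: step_neq0 hb | apply: step_neq0 hc].
have : (a' * b' * c') ^+ 2 * S3 a b c
         = c' ^+ 2 * (S3 a' b' c' * S3 a' b' c'^-1).
  rewrite (stepE ha) (stepE hb) (stepE hc) /S3.
  apply: (@eq_mod2 _ _ (2%:R * ((a' * b' * c') ^+ 2 * (a' ^+ 2 + b' ^+ 2 + c' ^+ 2 + 2%:R)
     + (a' * c') ^+ 2 + (b' * c') ^+ 2 + (a' * b') ^+ 2))).
  by field; rewrite a0 b0 c0.
rewrite h mulr0 => /esym/eqP; rewrite mulf_eq0 expf_eq0 (negPf c0) /= mulf_eq0.
case/orP => /eqP e; first by exists c'.
by exists c'^-1 => //; apply: stepV.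
Qed.

(* [S3 a b t = 0] is an Artin-Schreier equation for [t (a + b)^2 / (a b)]. *)
Lemma S3_frob n a b t : a != 0 -> b != 0 -> a != b -> S3 a b t = 0 ->
    frob n (a + b) = a + b -> frob n (a * b) = a * b ->
    tr n (a + a^-1 + (b + b^-1)) = 0 ->
  frob n t = t.
Proof.
move=> a0 b0 nab h fs fp htr.
have s0 : a + b != 0 by rewrite eq_add0.
have p0 : a * b != 0 by rewrite mulf_neq0.
pose y := t * (a + b) ^+ 2 / (a * b).
have e : y ^+ 2 + y = (a + a^-1 + (b + b^-1)) ^+ 2.
  have -> : y ^+ 2 + y = (a + a^-1 + (b + b^-1)) ^+ 2
     + (a + b) ^+ 2 / (a * b) ^+ 2 * S3 a b t
     + 2%:R * (t ^+ 2 * (a + b) ^+ 2 / (a * b)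
                 - ((a + b) * (a * b + 1) / (a * b)) ^+ 2
                 + (a + b) ^+ 2 / (a * b)).
    by rewrite /y /S3; field; rewrite a0 b0.
  by rewrite h two0 mulr0 mul0r !addr0.
have fy : frob n y = y by rewrite (AS_frob n e) tr_sqr htr expr0n addr0.
(* Besides [y], only [a + b] and [a * b] enter, so [a] and [b] may also be conjugate over
   F_(2^n). *)
have -> : t = y * (a * b) / (a + b) ^+ 2.
  by rewrite /y divfK // mulfK // expf_neq0.
by rewrite (frobM n (y * _)) (frobM n y) frobV frobX fy fs fp.
Qed.

(** * Torsion points and their fields of definition *)

(* x-coordinates of the points of order exactly [V ^ (j + 1)]. *)
Fixpoint tors j t : Prop :=
  if j is i.+1 then exists2 u, tors i u & step u t else t = 0.

(** As [frob n b = b^-1], both [b] and [b^-1] have relative trace [b + b^-1 = a]; transitivity gives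
    the absolute traces. *)
Lemma step_inert n a b : a != 0 -> frob n a = a -> tr n a^-1 = 1 -> step a b ->
  [/\ frob n b = b^-1, frob (2 * n) b = b, tr (2 * n) b = tr n a
    & tr (2 * n) b^-1 = tr n a].
Proof.
move=> a0 fa ta h; have fb := (step_frob_fix a0 fa h).2 ta.
split=> //; first by rewrite (frob_mul_inv 2 fb).
  by rewrite tr_double fb -(stepE h).
by rewrite tr_double frobV fb invrK addrC -(stepE h).
Qed.

(** Above [t = 0] lies only [t = 1], with both traces 1; from there every step is inert, doubling
    the exponent and keeping both traces equal to 1. *)
Lemma torsA j t : tors j.+1 t ->
  [/\ t != 0, frob (2 ^ j) t = t, tr (2 ^ j) t = 1 & tr (2 ^ j) t^-1 = 1].
Proof.
elim: j t => [|j IH] t [u hu h].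
  have -> : t = 1.
    apply: (@frob_inj 1); rewrite /frob expn1 expr1n; apply/eqP.
    by rewrite -eq_add0 h hu mul0r.
  by rewrite invr1 oner_neq0 frob_1 /tr big_ord1 frob_1.
have [u0 fu tu tv] := IH _ hu.
have [ft f2t t1 t2] := step_inert u0 fu tv h.
by rewrite expnS t1 t2 tu (step_neq0 h).
Qed.

(** [frob (2 ^ j)] inverts [t], hence so does its [m]-th iterate for odd [m], and [t] differs from
    its inverse. *)
Lemma tors_nfix j m t : odd m -> tors j.+2 t -> frob (2 ^ j * m) t != t.
Proof.
move=> om [u hu h]; have [u0 fu _ tu] := torsA hu.
have [ft _ _ _] := step_inert u0 fu tu h.
by rewrite mulnC (frob_mul_inv m ft) om eq_sym (step_neq_inv u0 h).
Qed.

(** * Degrees and types of field elements *)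

(** The degree over F_2 expressed by Frobenius alone. For [n = 0] no positive power fixes [x], hence
    the bounds [0 < n] on minimal polynomials below. *)
Definition has_deg n x := forall k, (frob k x == x) = (n %| k)%N.

Lemma has_deg_frob n x : has_deg n x -> frob n x = x.
Proof. by move=> h; apply/eqP; rewrite h dvdnn. Qed.

Lemma has_deg_step_split n a b : a != 0 -> has_deg n a -> tr n a^-1 = 0 ->
  step a b -> has_deg n b.
Proof.
move=> a0 da ta h k.
have fb := (step_frob_fix a0 (has_deg_frob da) h).1 ta.
apply/idP/idP => [/eqP e|/dvdnP[q ->]]; last by rewrite frob_mul.
by rewrite -da {1}(stepE h) frobD frobV e -(stepE h).
Qed.

Lemma has_deg_step_inert n a b : a != 0 -> has_deg n a -> tr n a^-1 = 1 ->
  step a b -> has_deg (2 * n) b.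
Proof.
move=> a0 da ta h k.
have [fb f2b _ _] := step_inert a0 (has_deg_frob da) ta h.
apply/idP/idP => [/eqP e|/dvdnP[q ->]]; last by rewrite frob_mul.
have : (n %| k)%N by rewrite -da {1}(stepE h) frobD frobV e -(stepE h).
case/dvdnP => q kE; move: e; rewrite kE (frob_mul_inv q fb).
case: ifPn => [_ /eqP|oq _]; first by rewrite eq_sym (negPf (step_neq_inv a0 h)).
by rewrite dvdn_mul // dvdn2.
Qed.

(** The type of the minimal polynomial read off a root: by Vieta [u] is [a_(n-1)] and [v] is [a_1],
    so [kind 1 1], [kind 0 1], [kind 1 0], [kind 0 0] are A, B, C, D. *)
Definition kind u v n x := [/\ x != 0, has_deg n x, tr n x = u & tr n x^-1 = v].

Lemma kind_neq0 u v n x : kind u v n x -> x != 0. Proof. by case. Qed.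

Lemma kind_deg u v n x : kind u v n x -> has_deg n x. Proof. by case. Qed.

(** The traces of [b] and [b^-1] sum to [tr n a = 0], so they agree. *)
Lemma kindD_step n a b : kind 0 0 n a -> step a b ->
  kind 1 1 n b \/ kind 0 0 n b.
Proof.
move=> [a0 da ta ta'] h; have db := has_deg_step_split a0 da ta' h.
have b0 := step_neq0 h.
have /eqP : tr n b + tr n b^-1 = 0 by rewrite -trD -(stepE h).
rewrite eq_add0 => /eqP e.
case: (tr_frobE (has_deg_frob db)) => t; [right|left]; split=> //; by rewrite -e.
Qed.

Lemma kindA_step n a b : kind 1 1 n a -> step a b -> kind 1 1 (2 * n) b.
Proof.
move=> [a0 da ta ta'] h; have db := has_deg_step_inert a0 da ta' h.
have [_ _ t1 t2] := step_inert a0 (has_deg_frob da) ta' h.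
by split; rewrite ?t1 ?t2 // (step_neq0 h).
Qed.

Lemma kindB_step n a b : kind 0 1 n a -> step a b ->
  kind 0 0 (2 * n) b /\ frob n b = b^-1.
Proof.
move=> [a0 da ta ta'] h; have db := has_deg_step_inert a0 da ta' h.
have [fb _ t1 t2] := step_inert a0 (has_deg_frob da) ta' h.
by split=> //; split; rewrite ?t1 ?t2 // (step_neq0 h).
Qed.

(** The traces of the two preimages [b] and [b^-1] sum to 1, so exactly one of them has trace 0. *)
Lemma kindC_step n a b : kind 1 0 n a -> step a b ->
  kind 0 1 n b \/ kind 0 1 n b^-1.
Proof.
move=> [a0 da ta ta'] h; have db := has_deg_step_split a0 da ta' h.
have db' := has_deg_step_split a0 da ta' (stepV h).
have b0 := step_neq0 h.
have e : tr n b + tr n b^-1 = 1 by rewrite -trD -(stepE h).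
case: (tr_frobE (has_deg_frob db)) => t; rewrite t in e.
  by left; split=> //; rewrite -e add0r.
right; split; rewrite ?invr_eq0 ?invrK //.
by apply: (addrI 1); rewrite addr0.
Qed.

(** * Chains of preimages and the escape from type D *)

Definition chain (c : nat -> K) := forall i, step (c i) (c i.+1).

Definition scons (x : K) (c : nat -> K) i := if i is j.+1 then c j else x.

Lemma chain_scons x c : step x (c 0%N) -> chain c -> chain (scons x c).
Proof. by move=> h hc [|i]; [apply: h | apply: hc]. Qed.

Lemma chainA n c s i : chain c -> kind 1 1 n (c s) ->
  kind 1 1 (2 ^ i * n) (c (i + s)%N).
Proof.
move=> hc h; elim: i => [|i IH]; first by rewrite mul1n.
by rewrite expnS -mulnA; apply: kindA_step IH (hc _).
Qed.

Lemma chainD n c k : chain c -> kind 0 0 n (c 0%N) ->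
  (exists2 j, (j <= k)%N & kind 1 1 n (c j))
  \/ (forall j, (j <= k)%N -> kind 0 0 n (c j)).
Proof.
move=> hc h0; elim: k => [|k [[j jk hj]|IH]].
- by right=> j; rewrite leqn0 => /eqP ->.
- by left; exists j => //; apply: leqW.
have [hk|hk] := kindD_step (IH k (leqnn k)) (hc k); first by left; exists k.+1.
by right=> j; rewrite leq_eqVlt => /predU1P[->//|]; apply: IH.
Qed.

Variable r : K -> K.
Hypothesis rP : forall a, step a (r a).

Lemma chain_iter x : chain (fun i => iter i r x).
Proof. by move=> i; apply: rP. Qed.

(** Inverse starting values differ by the point with x-coordinate 0 in the kernel of V, as
    [S3 a b 0 = (a b)^2 + 1]. Each step on both chains lifts the difference through V. *)
Lemma chains_S3 a b j : chain a -> chain b -> a 0%N * b 0%N = 1 ->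
  exists2 t, tors j t & S3 (a j) (b j) t = 0.
Proof.
move=> ha hb ab1; elim: j => [|j [t ht h]].
  exists 0 => //; rewrite /S3 ab1 !(mulr0, mul0r, expr1n) expr0n !addr0.
  exact: addKK.
have [t' st ht'] := S3_step (ha j) (hb j) (rP t) h.
by exists t' => //; exists t.
Qed.

Lemma chains_neq a b j : chain a -> chain b -> a 0%N != b 0%N -> a j != b j.
Proof.
move=> ha hb h0; elim: j => [|j]; first exact: h0.
apply: contra_neq => e.
by rewrite (stepE (ha j)) (stepE (hb j)) e.
Qed.

(** The difference of the members at [l.+2] has order V^(l+3), too large to be fixed by [frob n],
    yet [S3_frob] makes it fixed. The trace condition sits at [l.+1] since
    [a l.+2 + (a l.+2)^-1 = a l.+1]. *)
Lemma chains_absurd a b l m : odd m -> chain a -> chain b ->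
    a 0%N * b 0%N = 1 -> a 0%N != b 0%N ->
    let n := (2 ^ l * m)%N in
    frob n (a l.+2 + b l.+2) = a l.+2 + b l.+2 ->
    frob n (a l.+2 * b l.+2) = a l.+2 * b l.+2 ->
    tr n (a l.+1 + b l.+1) = 0 ->
  False.
Proof.
move=> om ha hb ab1 nab n fs fp htr.
have [t /(tors_nfix om)/negP ht h] := chains_S3 l.+2 ha hb ab1.
apply/ht/eqP; apply: S3_frob h fs fp _.
- exact: step_neq0 (ha _).
- exact: step_neq0 (hb _).
- exact: chains_neq.
by rewrite -(stepE (ha _)) -(stepE (hb _)).
Qed.

Lemma escapeD l m x : odd m -> kind 0 0 (2 ^ l * m) x ->
  exists c s, [/\ chain c, c 0%N = x, (s <= l + 2)%N & kind 1 1 (2 ^ l * m) (c s)].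
Proof.
set n := (2 ^ l * m)%N => om hx.
(* The chains start at the two preimages of [x]. Prefixing [x] shifts indices by one: type D up to
   [l + 2] there means up to [l.+1] in [a] and [b]. *)
pose a i := iter i r (r x); pose b i := iter i r (r x)^-1.
have ca : chain (scons x a) by apply: chain_scons (chain_iter _); apply: rP.
have cb : chain (scons x b) by apply: chain_scons (chain_iter _); apply: stepV (rP x).
have [[j hj kj]|Da] := chainD (l + 2) ca hx.
  by exists (scons x a), j.
have [[j hj kj]|Db] := chainD (l + 2) cb hx.
  by exists (scons x b), j.
exfalso; rewrite !addn2 in Da Db.
have {}Da i : (i <= l.+1)%N -> kind 0 0 n (a i) by move=> h; apply: (Da i.+1).
have {}Db i : (i <= l.+1)%N -> kind 0 0 n (b i) by move=> h; apply: (Db i.+1).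
(* A step from type D is split, so the members at [l.+2] are still fixed by [frob n]. *)
have fix_step c : kind 0 0 n c -> frob n (r c) = r c.
  by move=> hc; case: (kindD_step hc (rP c)) => /kind_deg/has_deg_frob.
have fa : frob n (a l.+2) = a l.+2 := fix_step _ (Da _ (leqnn _)).
have fb : frob n (b l.+2) = b l.+2 := fix_step _ (Db _ (leqnn _)).
apply: (@chains_absurd a b l m om (chain_iter _) (chain_iter _)).
- by rewrite divff // (step_neq0 (rP x)).
- exact: step_neq_inv (kind_neq0 hx) (rP x).
- by rewrite frobD fa fb.
- by rewrite frobM fa fb.
by case: (Da _ (leqnn _)) => _ _ ta _; case: (Db _ (leqnn _)) => _ _ tb _; rewrite trD ta tb addr0.
Qed.

Lemma escapeB l m x : odd m -> kind 0 1 (2 ^ l * m) x ->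
  exists c s, [/\ chain c, c 0%N = x, (s <= l + 2)%N
                & kind 1 1 (2 * (2 ^ l * m)) (c s)].
Proof.
set n := (2 ^ l * m)%N => om hx.
(* The second chain is the conjugate of the first and starts at [frob n (r x) = (r x)^-1]. *)
pose a i := iter i r (r x); pose b i := frob n (a i).
have ca : chain a by apply: chain_iter.
have cb : chain b by move=> i; apply: step_frob (ca i).
have [k0 f0] := kindB_step hx (rP x).
have [[j hj kj]|Da] := chainD l.+1 ca k0.
  by exists (scons x a), j.+1; split=> //; [apply: chain_scons => //; apply: rP | rewrite addn2].
exfalso.
have fa : frob (2 * n) (a l.+2) = a l.+2.
  by case: (kindD_step (Da _ (leqnn _)) (rP _)) => /kind_deg/has_deg_frob.
have fb : frob n (b l.+2) = a l.+2 by rewrite frobA addnn -mul2n fa.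
apply: (@chains_absurd a b l m om ca cb).
- by rewrite /b /= f0 divff // (step_neq0 (rP x)).
- rewrite /b /= f0; exact: step_neq_inv (kind_neq0 hx) (rP x).
- by rewrite frobD fb addrC.
- by rewrite frobM fb mulrC.
(* The trace of [a l.+1] from degree [2 * n], zero in type D, passes through its relative trace
   [a l.+1 + b l.+1]. *)
by case: (Da _ (leqnn _)) => _ _ ta _; rewrite -tr_double ta.
Qed.

End CharTwo.

(** * Polynomials over F_2 and the degree of the Q-transform *)

Lemma F2P (c : 'F_2) : c = 0 \/ c = 1.
Proof. by case: c => [[|[|k]] hk] //; [left|right]; apply: val_inj. Qed.

Lemma monic_F2 (f : {poly 'F_2}) : f != 0 -> f \is monic.
Proof. by rewrite monicE -lead_coef_eq0; case: (F2P (lead_coef f)) => ->. Qed.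

(** Both are monic. This turns divisibility with equal degrees into equality. *)
Lemma eqp_F2 (f g : {poly 'F_2}) : f != 0 -> f %= g -> f = g.
Proof.
move=> f0 e; have g0 : g != 0 by apply: contraNneq f0 => g0; rewrite -eqp0 -g0.
by apply/eqP; rewrite -eqp_monic ?monic_F2.
Qed.

(** Vieta: up to sign the two coefficients are [e_(n-1)] and [e_n] of the roots, whose quotient is
    the sum of the inverses. *)
Lemma coef1_prod_XsubC (F : fieldType) (ps : seq F) : all (predC1 0) ps ->
  (\prod_(p <- ps) ('X - p%:P))`_1
    = - (\prod_(p <- ps) ('X - p%:P))`_0 * \sum_(p <- ps) p^-1.
Proof.
elim: ps => [|p ps IH] /=; first by rewrite !big_nil coef1 mulr0.
case/andP=> p0 /IH {}IH; rewrite !big_cons !mulrBl !coefB !coefXM !coefCM IH /=.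
by field.
Qed.

(** The summand of index [i] has degree at most [n + i], so the top term comes from [i = n]
    alone. *)
Lemma size_Qtransform (f : {poly 'F_2}) : f != 0 ->
  size (Qtransform f) = (2 * (size f).-1).+1.
Proof.
move=> f0; have : (0 < size f)%N by rewrite size_poly_gt0.
rewrite /Qtransform; case E: (size f) => [//|n] _ /=.
have sM k : size (('X^2 + 1 : {poly 'F_2}) ^+ k) = (2 * k).+1.
  have s3 : size ('X^2 + 1 : {poly 'F_2}) = 3 by rewrite -polyC1 size_XnaddC.
  by have := size_exp ('X^2 + 1 : {poly 'F_2}) k; rewrite s3 => <-; rewrite prednK // size_poly_gt0 expf_neq0 // -size_poly_gt0 s3.
rewrite big_ord_recr /= subnn expr0 mul1r addrC.
have fn : f`_n != 0 by rewrite -[n]/(n.+1.-1) -E lead_coef_eq0.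
rewrite size_polyDl size_scale // sM //.
rewrite ltnS (leq_trans (size_sum _ _ _)) //.
apply/bigmax_leqP => i _; rewrite (leq_trans (size_scale_leq _ _)) //.
rewrite (leq_trans (size_polyMleq _ _)) // size_polyXn sM addSn /=.
by have := ltn_ord i; lia.
Qed.

(** * Conjugates, minimal polynomials and their coefficients *)

Section Roots.

Variables (K : fieldType) (phi : {rmorphism 'F_2 -> K}).

Local Notation "f ^phi" := (map_poly phi f) (at level 2, format "f ^phi").

Lemma pchar_F2_ext : 2 \in [pchar K].
Proof. by apply: (rmorph_pchar phi); rewrite inE /= -(pchar_Fp_0 (isT : prime 2)). Qed.

Let char2 := pchar_F2_ext.

Lemma frob_horner k (f : {poly 'F_2}) x : frob k f^phi.[x] = f^phi.[frob k x].
Proof.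
rewrite !horner_coef (frob_sum char2); apply: eq_bigr => i _.
rewrite frobM frobX coef_map /=; congr (_ * _).
by case: (F2P f`_i) => ->; rewrite ?rmorph0 ?rmorph1 ?frob_0 ?frob_1.
Qed.

Lemma root_frob k (f : {poly 'F_2}) x : root f^phi x -> root f^phi (frob k x).
Proof. by rewrite /root -frob_horner frob_eq0. Qed.

(** Pigeonhole: two of the [X^(2^i)] agree modulo [f]; evaluate at [x] and cancel the smaller
    exponent by injectivity of Frobenius. *)
Lemma algebraic_periodic x (f : {poly 'F_2}) : f != 0 -> root f^phi x ->
  exists d, (0 < d)%N && (frob d x == x).
Proof.
move=> f0 fx; set T := 'rV['F_2]_(size f).
pose g (i : 'I_#|{: T}|.+1) : T := poly_rV ('X^(2 ^ i) %% f).
have /injectivePn[i [j nij gij]] : ~~ injectiveb g.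
  by apply/negP => /injectiveP/leq_card; rewrite card_ord ltnn.
have hm p : (p %% f)^phi.[x] = p^phi.[x].
  rewrite {2}(divp_eq p f) rmorphD rmorphM /= hornerD hornerM.
  by rewrite (rootP fx) mulr0 add0r.
have eij : frob i x = frob j x.
  have e : 'X^(2 ^ i) %% f = 'X^(2 ^ j) %% f.
    by have := congr1 rVpoly gij; rewrite /g !poly_rV_K // ltnW // ltn_modp.
  by have := hm 'X^(2 ^ i); rewrite e hm !map_polyXn !hornerXn.
wlog lt_ij : i j nij gij eij / (i < j)%N.
  move=> W; case: (ltngtP i j) => [|h|/val_inj h]; first exact: W.
    by apply: (W j i _ (esym gij) (esym eij) h); rewrite eq_sym.
  by rewrite h eqxx in nij.
exists (j - i)%N; rewrite subn_gt0 lt_ij /=; apply/eqP; apply: (frob_inj char2 (n := i)).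
by rewrite frobA subnKC ?(ltnW lt_ij) // eij.
Qed.

Lemma has_deg_inj m n (x : K) : has_deg m x -> has_deg n x -> m = n.
Proof.
move=> hm hn; apply/eqP; rewrite eqn_dvd -hm -hn.
by rewrite (has_deg_frob hm) (has_deg_frob hn) !eqxx.
Qed.

Lemma periodic_has_deg (x : K) (H : exists d, (0 < d)%N && (frob d x == x)) :
  has_deg (ex_minn H) x.
Proof.
case: ex_minnP => d /andP[d0 /eqP hd] dmin k.
apply/idP/idP => [/eqP e|/dvdnP[q ->]]; last by rewrite frob_mul.
have hk : frob (k %% d) x = x.
  by rewrite -{2}e {2}(divn_eq k d) addnC -frobA frob_mul.
rewrite /dvdn -leqn0 leqNgt; apply/negP => kd.
by have := dmin (k %% d)%N; rewrite kd hk eqxx leqNgt ltn_pmod // => /(_ isT).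
Qed.

Definition conjs n (x : K) := [seq frob i x | i <- iota 0 n].

Lemma uniq_conjs n x : has_deg n x -> uniq (conjs n x).
Proof.
move=> h; rewrite map_inj_in_uniq ?iota_uniq // => i j.
rewrite !mem_iota /= !add0n.
wlog le_ij : i j / (i <= j)%N.
  by move=> W hi hj e; case/orP: (leq_total i j) => l; [apply: W | apply/esym/W].
move=> hi hj; rewrite -{1}(subnKC le_ij) -(frobA i) => /(frob_inj char2)/esym/eqP.
rewrite h => d; case: (posnP (j - i)) => [|p].
  by move/eqP; rewrite subn_eq0 => l; apply/eqP; rewrite eqn_leq le_ij.
by have := dvdn_leq p d; rewrite leqNgt (leq_ltn_trans (leq_subr _ _) hj).
Qed.

Lemma size_root_gt n x (f : {poly 'F_2}) : has_deg n x -> f != 0 ->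
  root f^phi x -> (n < size f)%N.
Proof.
move=> h f0 fx; have := @max_poly_roots _ f^phi (conjs n x).
rewrite map_poly_eq0 f0 size_map size_iota size_map_poly; apply=> //.
  by apply/allP => _ /mapP[i _ ->]; apply: root_frob.
exact: uniq_conjs.
Qed.

Lemma irreducible_dvd_root (f h : {poly 'F_2}) x : irreducible_poly f ->
  root f^phi x -> root h^phi x -> f %| h.
Proof.
move=> irr fx hx; have g : root (gcdp f h)^phi x by rewrite gcdp_map root_gcd fx.
have : gcdp f h %= f.
  apply: irr.2 (dvdp_gcdl _ _); apply: contraTneq g => /eqP/size_poly1P[c c0 ->].
  by rewrite map_polyC rootC fmorph_eq0.
by move/eqp_dvdl <-; apply: dvdp_gcdr.
Qed.

Lemma irreducible_root_inj (f g : {poly 'F_2}) x : irreducible_poly f ->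
  irreducible_poly g -> root f^phi x -> root g^phi x -> f = g.
Proof.
move=> irf irg fx gx; apply: eqp_F2; first exact: irredp_neq0.
by apply/andP; split; apply: irreducible_dvd_root irf fx _ || apply: irreducible_dvd_root irg gx _.
Qed.

Definition minpol n (x : K) : {poly 'F_2} :=
  map_poly (fun c : K => if c == 0 then 0 else 1)
    (\prod_(z <- conjs n x) ('X - z%:P)).

(** Frobenius permutes the conjugates cyclically, so each coefficient satisfies [c^2 = c]. *)
Lemma minpolE n x : has_deg n x -> (0 < n)%N ->
  (minpol n x)^phi = \prod_(z <- conjs n x) ('X - z%:P).
Proof.
case: n => // n h _; set P := \prod_(z <- _) _.
have PF : map_poly (pFrobenius_aut char2) P = P.
  rewrite /P rmorph_prod /= /conjs !big_map.
  have e : iota 0 n.+1 = 0%N :: [seq i.+1 | i <- iota 0 n].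
    by rewrite /= (iotaDl 1 0).
  rewrite [in RHS]e big_cons big_map -addn1 iotaD big_cat /= add0n big_seq1 mulrC.
  congr (_ * _).
    rewrite map_polyXsubC /= pFrobenius_autE -frobS.
    by rewrite (has_deg_frob h) frob0.
  by apply: eq_bigr => i _; rewrite map_polyXsubC /= pFrobenius_autE -frobS.
apply/polyP => i; rewrite coef_map /= coef_map_id0 ?eqxx //.
have : P`_i ^+ 2 = P`_i by rewrite -[in RHS]PF coef_map.
move/eqP; rewrite -subr_eq0 expr2 -{3}[P`_i]mulr1 -mulrBr mulf_eq0 subr_eq0.
case: eqP => [-> _|_ /= /eqP ->]; first by rewrite rmorph0.
by rewrite rmorph1.
Qed.

Lemma size_minpol n x : has_deg n x -> (0 < n)%N -> size (minpol n x) = n.+1.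
Proof.
move=> h n0; rewrite -(size_map_poly phi) minpolE // size_prod_XsubC.
by rewrite size_map size_iota.
Qed.

Lemma root_minpol n x : has_deg n x -> (0 < n)%N -> root (minpol n x)^phi x.
Proof.
move=> h n0; rewrite minpolE // root_prod_XsubC; apply/mapP; exists 0%N.
  by rewrite mem_iota.
by rewrite frob0.
Qed.

(** One of two factors has the root [x], hence degree at least [n], which leaves a constant for the
    other. *)
Lemma minpol_irr n x : has_deg n x -> (0 < n)%N -> irreducible_poly (minpol n x).
Proof.
move=> h n0; have sm := size_minpol h n0; split; first by rewrite sm ltnS.
have m0 : minpol n x != 0 by rewrite -size_poly_gt0 sm.
move=> q sq dq; have := dq; rewrite dvdp_eq => /eqP e.
set s := _ %/ q in e.
have [s0 q0] : s != 0 /\ q != 0.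
  by apply/andP; move: m0; rewrite e mulf_eq0 negb_or.
have es : size (minpol n x) = (size s + size q).-1 by rewrite e size_mul.
have := root_minpol h n0; rewrite e rmorphM /= rootM => /orP[] hr.
  have hs := size_root_gt h s0 hr; have hq : (0 < size q)%N by rewrite size_poly_gt0.
  exfalso; move: es sq hq; rewrite sm; case: (size q) => [|[|k]] //.
  by rewrite !addnS /= => -[en] _ _; move: hs; rewrite en ltnNge leq_addr.
rewrite -e -dvdp_size_eqp //; have := size_root_gt h q0 hr.
by have := dvdp_leq m0 dq; rewrite sm eqn_leq => -> ->.
Qed.

Lemma irreducible_minpol n x (f : {poly 'F_2}) : irreducible_poly f ->
  size f = n.+1 -> root f^phi x -> has_deg n x /\ f = minpol n x.
Proof.
move=> irr sf fx; have H := algebraic_periodic (irredp_neq0 irr) fx.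
have h := periodic_has_deg H.
have d0 : (0 < ex_minn H)%N by case: ex_minnP => d /andP[].
have e := irreducible_root_inj irr (minpol_irr h d0) fx (root_minpol h d0).
suff en : ex_minn H = n by rewrite -en.
by apply/eqP; rewrite -eqSS -sf [in X in _ == X]e size_minpol.
Qed.

Lemma phi_eq (a b : 'F_2) : phi a = phi b -> a = b.
Proof. exact: fmorph_inj. Qed.

Lemma sum_conjs n x : \sum_(z <- conjs n x) z = tr n x.
Proof. by rewrite big_map /tr -(big_mkord xpredT (fun i => frob i x)) /index_iota subn0. Qed.

Lemma sumV_conjs n x : \sum_(z <- conjs n x) z^-1 = tr n x^-1.
Proof.
rewrite -sum_conjs !big_map; apply: eq_bigr => i _; by rewrite frobV.
Qed.

Lemma coefPn_irreducible n x (f : {poly 'F_2}) : irreducible_poly f ->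
  size f = n.+1 -> root f^phi x -> phi f`_n.-1 = tr n x.
Proof.
move=> irr sf fx; have [h fE] := irreducible_minpol irr sf fx.
have n0 : (0 < n)%N by have := irr.1; rewrite sf ltnS.
rewrite -coef_map /= fE minpolE // -sum_conjs -[RHS](opp_pchar2 char2).
have sc : size (conjs n x) = n by rewrite size_map size_iota.
by rewrite -coefPn_prod_XsubC sc -?lt0n.
Qed.

(** The constant term is up to sign a product of nonzero conjugates, hence 1, so [a_1] is the sum of
    their inverses. *)
Lemma coef1_irreducible n x (f : {poly 'F_2}) : x != 0 -> irreducible_poly f ->
  size f = n.+1 -> root f^phi x -> phi f`_1 = tr n x^-1.
Proof.
move=> x0 irr sf fx; have [h fE] := irreducible_minpol irr sf fx.
have n0 : (0 < n)%N by have := irr.1; rewrite sf ltnS.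
have c0 : all (predC1 0) (conjs n x).
  by apply/allP => _ /mapP[i _ ->]; rewrite /= frob_eq0.
have f0 : f`_0 = 1.
  case: (F2P f`_0) => // e.
  have : (f^phi)`_0 = 0 by rewrite coef_map /= e rmorph0.
  rewrite fE minpolE // coef0_prod_XsubC => /eqP.
  rewrite mulf_eq0 signr_eq0 /= prodf_seq_eq0 => /hasP[z /(allP c0) /= z0].
  by rewrite (negPf z0).
rewrite -coef_map /= fE minpolE // coef1_prod_XsubC // -minpolE // -fE.
by rewrite coef_map /= f0 rmorph1 opp_pchar2 // mul1r sumV_conjs.
Qed.

(** The dictionary between polynomials and roots. It fails at [x = 0], where [0^-1 = 0] has trace 0
    although X has [a_1 = 1]; the theorem treats X separately. *)
Lemma has_typeP a b n x (f : {poly 'F_2}) : x != 0 -> irreducible_poly f ->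
  root f^phi x -> has_type a b f n <-> kind (phi a) (phi b) n x.
Proof.
move=> x0 irr fx; split=> [[_ sf <- <-]|[_ dx ta tb]].
  split=> //; first exact: (irreducible_minpol irr sf fx).1.
    by rewrite (coefPn_irreducible irr sf fx).
  by rewrite (coef1_irreducible x0 irr sf fx).
have sf : size f = n.+1.
  have e : size f = (size f).-1.+1 by rewrite prednK // (ltn_trans _ irr.1).
  by rewrite e (has_deg_inj (irreducible_minpol irr e fx).1 dx).
split=> //; apply: phi_eq.
  by rewrite (coefPn_irreducible irr sf fx).
by rewrite (coef1_irreducible x0 irr sf fx).
Qed.

(** * From chains of roots to sequences of polynomials *)

Lemma horner_Qtransform (f : {poly 'F_2}) a b : step a b ->
  (Qtransform f)^phi.[b] = b ^+ (size f).-1 * f^phi.[a].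
Proof.
move=> h; rewrite /Qtransform rmorph_sum /= horner_sum horner_coef size_map_poly mulr_sumr.
apply: eq_bigr => i _.
have hi : (i <= (size f).-1)%N by rewrite -ltnS (ltn_predK (ltn_ord i)).
rewrite map_polyZ rmorphM !rmorphXn /= rmorphD rmorph1 rmorphXn /= map_polyX.
rewrite hornerZ hornerM !horner_exp hornerD horner_exp hornerX -polyC1 hornerC h.
rewrite coef_map exprMn [RHS]mulrCA; congr (_ * _).
by rewrite -[in RHS](subnK hi) exprD -mulrA; congr (_ * _); rewrite mulrC.
Qed.

Lemma root_Qtransform (f : {poly 'F_2}) a b : step a b -> root f^phi a ->
  root (Qtransform f)^phi b.
Proof. by move=> h /rootP fa; rewrite /root (horner_Qtransform f h) fa mulr0. Qed.

Hypothesis phi_int : integralRange phi.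

Lemma periodic (x : K) : exists d, (0 < d)%N && (frob d x == x).
Proof.
have [f fm fx] := phi_int x.
by apply: algebraic_periodic fx; apply: monic_neq0.
Qed.

Definition minpoly (x : K) := minpol (ex_minn (periodic x)) x.

Lemma minpolyP x : irreducible_poly (minpoly x) /\ root (minpoly x)^phi x.
Proof.
have h := periodic_has_deg (periodic x).
have d0 : (0 < ex_minn (periodic x))%N by case: ex_minnP => d /andP[].
by split; [apply: minpol_irr | apply: root_minpol].
Qed.

Lemma minpoly_irr x : irreducible_poly (minpoly x).
Proof. exact: (minpolyP x).1. Qed.

Lemma minpoly_eq x f : irreducible_poly f -> root f^phi x -> minpoly x = f.
Proof.
move=> irr fx; exact: irreducible_root_inj (minpolyP x).1 irr (minpolyP x).2 fx.
Qed.

Lemma minpoly_dvd x f : root f^phi x -> minpoly x %| f.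
Proof. exact: irreducible_dvd_root (minpolyP x).1 (minpolyP x).2. Qed.

Lemma size_minpoly n x : has_deg n x -> size (minpoly x) = n.+1.
Proof.
move=> h; rewrite /minpoly (has_deg_inj (periodic_has_deg (periodic x)) h).
apply: size_minpol => //; rewrite -(has_deg_inj (periodic_has_deg (periodic x)) h).
by case: ex_minnP => d /andP[].
Qed.

Lemma minpoly_kindA n x : kind 1 1 n x -> typeA (minpoly x) n.
Proof.
move=> h; apply/(has_typeP _ _ _ (kind_neq0 h) (minpoly_irr x) (minpolyP x).2).
by rewrite rmorph1.
Qed.

Lemma minpoly_chain_dvd c i : chain c ->
  minpoly (c i.+1) %| Qtransform (minpoly (c i)).
Proof.
by move=> hc; apply: minpoly_dvd (root_Qtransform (hc i) (minpolyP (c i)).2).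
Qed.

(** From [s] on the degree of the root doubles, so the minimal polynomial divides a Q-transform of
    its own degree. *)
Lemma minpoly_chainA n c s i : chain c -> kind 1 1 n (c s) -> (s <= i)%N ->
  minpoly (c i.+1) = Qtransform (minpoly (c i)) /\
  (size (minpoly (c i.+1))).-1 = (2 * (size (minpoly (c i))).-1)%N.
Proof.
move=> hc hs le_si.
have := chainA pchar_F2_ext (i - s) hc hs; rewrite subnK // => hi.
have s1 := size_minpoly (kind_deg hi).
have s2 := size_minpoly (kind_deg (kindA_step pchar_F2_ext hi (hc i))).
split; last by rewrite s1 s2.
apply: eqp_F2; first exact: irredp_neq0 (minpoly_irr _).
rewrite -dvdp_size_eqp; last exact: minpoly_chain_dvd.
by rewrite s2 size_Qtransform ?s1 // -size_poly_gt0 s1.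
Qed.

Lemma sequence_of_chain f0 N c s : chain c -> irreducible_poly f0 ->
    root f0^phi (c 0%N) -> kind 1 1 N (c s) ->
  let f i := minpoly (c i) in
  [/\ f 0%N = f0, forall i, irreducible_poly (f i),
      forall i, f i.+1 %| Qtransform (f i), typeA (f s) N
    & forall i, (s <= i)%N -> f i.+1 = Qtransform (f i) /\
        (size (f i.+1)).-1 = (2 * (size (f i)).-1)%N].
Proof.
move=> hc irr f0c hs /=; split.
- exact: minpoly_eq.
- by move=> i; apply: minpoly_irr.
- by move=> i; apply: minpoly_chain_dvd.
- exact: minpoly_kindA.
by move=> i; apply: minpoly_chainA hs.
Qed.

End Roots.

(** * Assembly over an algebraic closure of F_2 *)

Lemma step_exists (K : closedFieldType) (a : K) : 2 \in [pchar K] ->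
  exists b, b ^+ 2 + 1 == a * b.
Proof.
move=> char2; have [b hb] := @solve_monicpoly K 2 (nth 0 [:: -1; a]) isT.
by exists b; rewrite hb !big_ord_recl big_ord0 /= mulr1 expr1 addr0 addrC addrA subrr add0r.
Qed.

Lemma has_type_inj a b a' b' n f :
  has_type a b f n -> has_type a' b' f n -> a = a' /\ b = b'.
Proof. by move=> [_ _ <- <-] [_ _ <- <-]. Qed.

Theorem mainTheorem1 (f0 : {poly 'F_2}) (n l m : nat)
    (f0_irr : irreducible_poly f0) (f0_deg : size f0 = n.+1)
    (n_def : n = (2 ^ l * m)%N) (m_odd : odd m) :
  exists (s : nat) (f : nat -> {poly 'F_2}),
    (s <= l + 3)%N /\
    f 0%N = f0 /\
    (forall i : nat, irreducible_poly (f i)) /\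
    (forall i : nat, f i.+1 %| Qtransform (f i)) /\
    (typeA (f s) n \/ typeA (f s) (2 * n)) /\
    (forall i : nat, (s <= i)%N ->
       f i.+1 = Qtransform (f i) /\
       (size (f i.+1)).-1 = (2 * (size (f i)).-1)%N) /\
    (typeA f0 n -> s = 0%N) /\
    (typeB f0 n -> (1 < n)%N -> (s <= l + 2)%N /\ typeA (f s) (2 * n)) /\
    (typeB f0 1 -> s = 1%N /\ f 1%N = 'X + 1) /\
    (typeC f0 n -> (s <= l + 3)%N /\ typeA (f s) (2 * n)) /\
    (typeD f0 n -> (s <= l + 2)%N /\ typeA (f s) n).
Proof.
have [K [phi phi_int]] := countable_algebraic_closure 'F_2.
have char2 : 2 \in [pchar K] := pchar_F2_ext phi.
pose r (a : K) := xchoose (step_exists a char2).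
have rP a : step a (r a) by apply/eqP/(xchooseP (step_exists a char2)).
have [x fx] : exists x, root (map_poly phi f0) x.
  by apply/closed_rootP; rewrite size_map_poly f0_deg eqSS -lt0n;
     have := f0_irr.1; rewrite f0_deg.
(* Root 0 means [f0 = X], of type (B,1); its only preimage is 1, the root of [X + 1]. *)
have [x0|x0] := eqVneq x 0.
  have irrX : irreducible_poly ('X : {poly 'F_2}).
    by rewrite -['X]addr0 -polyC0; apply: irredp_XaddC.
  have f0E : f0 = 'X.
    apply: irreducible_root_inj f0_irr irrX fx _.
    by rewrite map_polyX rootX x0.
  have n1 : n = 1%N by move: f0_deg; rewrite f0E size_polyX => -[].
  have B1 : typeB f0 1 by split; rewrite // f0E ?size_polyX ?coefX.
  have hc : chain (fun i => iter i r x) by apply: chain_iter.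
  have r1 : r x = 1.
    apply: (frob_inj char2 (n := 1)); rewrite /frob expn1 expr1n; apply/eqP.
    by rewrite -(eq_add0 char2) (rP x) x0 mul0r.
  have k1 : kind 1 1 n (r x).
    rewrite r1 n1; split; rewrite ?oner_neq0 ?invr1 //.
    - by move=> k; rewrite frob_1 eqxx dvd1n.
    - by rewrite /tr big_ord1 frob_1.
    - by rewrite /tr big_ord1 frob_1.
  have [f_0 firr fdvd fA fQ] := sequence_of_chain phi_int (s := 1) hc f0_irr fx k1.
  have nB a b : has_type a b f0 n -> a = 0 /\ b = 1.
    by rewrite n1 => h; apply: has_type_inj h B1.
  have absurd01 : (0 : 'F_2) <> 1 by [].
  exists 1%N, (fun i => minpoly phi_int (iter i r x)); split; first by rewrite addn3.
  split; first exact: f_0.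
  split; first exact: firr.
  split; first exact: fdvd.
  split; first by left.
  split; first exact: fQ.
  split; first by case/nB => /esym/absurd01.
  split; first by rewrite n1.
  split.
    split=> //=; apply: minpoly_eq; first by rewrite -polyC1; apply: irredp_XaddC.
    by rewrite r1 rmorphD rmorph1 /= map_polyX /root hornerD hornerX hornerC addrr_pchar2.
  split; first by case/nB => _ /absurd01.
  by case/nB => _ /absurd01.
(* For [n = 1] the index [n.-1] is 0, so type (B,1) forces a zero constant term and the root 0. *)
have notB1 : ~ typeB f0 1.
  case=> _ s2 c0 c1; have := fx; rewrite /root horner_coef size_map_poly s2.
  rewrite !big_ord_recl big_ord0 /= !coef_map /= c0 c1 rmorph0 rmorph1.
  by rewrite mul0r add0r mul1r addr0 expr1 (negPf x0).
have finish s N c : (s <= l + 3)%N -> chain c -> c 0%N = x -> kind 1 1 N (c s) ->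
    N = n \/ N = (2 * n)%N -> (typeA f0 n -> s = 0%N) ->
    (typeB f0 n -> (s <= l + 2)%N /\ N = (2 * n)%N) ->
    (typeC f0 n -> N = (2 * n)%N) ->
    (typeD f0 n -> (s <= l + 2)%N /\ N = n) ->
    exists (s : nat) (f : nat -> {poly 'F_2}),
      (s <= l + 3)%N /\
      f 0%N = f0 /\
      (forall i : nat, irreducible_poly (f i)) /\
      (forall i : nat, f i.+1 %| Qtransform (f i)) /\
      (typeA (f s) n \/ typeA (f s) (2 * n)) /\
      (forall i : nat, (s <= i)%N ->
         f i.+1 = Qtransform (f i) /\
         (size (f i.+1)).-1 = (2 * (size (f i)).-1)%N) /\
      (typeA f0 n -> s = 0%N) /\
      (typeB f0 n -> (1 < n)%N -> (s <= l + 2)%N /\ typeA (f s) (2 * n)) /\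
      (typeB f0 1 -> s = 1%N /\ f 1%N = 'X + 1) /\
      (typeC f0 n -> (s <= l + 3)%N /\ typeA (f s) (2 * n)) /\
      (typeD f0 n -> (s <= l + 2)%N /\ typeA (f s) n).
  move=> hs hc c0 ks hN hA hB hC hD.
  have [|f_0 firr fdvd fA fQ] := sequence_of_chain phi_int hc f0_irr _ ks.
    by rewrite c0.
  exists s, (fun i => minpoly phi_int (c i)); split; first exact: hs.
  split; first exact: f_0.
  split; first exact: firr.
  split; first exact: fdvd.
  split; first by case: hN => <-; [left|right].
  split; first exact: fQ.
  split; first exact: hA.
  split; first by move=> /hB[sl <-].
  split; first by move/notB1.
  split; first by move=> /hC <-.
  by move=> /hD[sl <-].
have T a b : has_type a b f0 n -> kind (phi a) (phi b) n x.
  exact: (has_typeP a b n x0 f0_irr fx).1.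
have neq01 : (0 : 'F_2) <> 1 by [].
have ty : has_type f0`_n.-1 f0`_1 f0 n by [].
have excl a b : f0`_n.-1 <> a \/ f0`_1 <> b -> ~ has_type a b f0 n.
  by move=> h /(has_type_inj ty)[e1 e2]; case: h.
have := T _ _ ty; rewrite /typeA /typeB /typeC /typeD in finish *.
(* The cases come in the order D, B, C, A. *)
case: (F2P f0`_n.-1) excl => ->; case: (F2P f0`_1) => -> excl;
  rewrite ?rmorph0 ?rmorph1 => kx.
- move: (kx); rewrite n_def => /(escapeD char2 rP m_odd)[c [s [hc c0 hs]]].
  rewrite -n_def => ks; apply: (finish s n c) => //; try by left.
  + by rewrite (leq_trans hs) // leq_add2l.
  + by case/excl; left => /neq01.
  + by case/excl; right => /neq01.
  by case/excl; left => /neq01.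
- move: (kx); rewrite n_def => /(escapeB char2 rP m_odd)[c [s [hc c0 hs]]].
  rewrite -n_def => ks; apply: (finish s (2 * n)%N c) => //; try by right.
  + by rewrite (leq_trans hs) // leq_add2l.
  + by case/excl; left => /neq01.
  by case/excl; right => /esym/neq01.
(* From type C a suitable preimage is of type B in the same degree; this extra step accounts for
   [l + 3]. *)
- have [b bx kb] : exists2 b, step x b & kind 0 1 n b.
    have := kindC_step char2 kx (rP x).
    by case=> kb; [exists (r x) | exists (r x)^-1] => //; apply: stepV.
  move: kb; rewrite n_def => /(escapeB char2 rP m_odd)[c [s [hc c0 hs]]].
  rewrite -n_def => ks; apply: (finish s.+1 (2 * n)%N (scons x c)) => //; try by right.
  + by rewrite addn3 ltnS -addn2.
  + by apply: chain_scons => //; rewrite c0.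
  + by case/excl; right => /neq01.
  + by case/excl; left => /esym/neq01.
  by case/excl; left => /esym/neq01.
apply: (finish 0%N n (fun i => iter i r x)) => //; try by left.
- by case/excl; left => /esym/neq01.
by case/excl; right => /esym/neq01.
Qed.
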